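(* Let $Q$ be a quantale and let $\Sigma_Q$ be a class of proper ideals of $Q$ such that $\mathrm{Max}_Q\subseteq \Sigma_Q$. Then the quantale space $\Sigma_Q$ is quasi-compact.
   Context: A quantale here means a complete lattice $(Q,\preccurlyeq,\bot,\top)$ with a binary operation $\&$ that is associative, commutative, satisfies $x\&\bigl(\bigvee_{\lambda} y_\lambda\bigr)=\bigvee_\lambda (x\& y_\lambda)$ for all families, and satisfies $x\&\top=x$ for all $x$. An ideal of $Q$ is a nonempty subset $I\subseteq Q$ such that $x,y\in I$ implies $x\vee y\in I$, and $x\in I$, $l\preccurlyeq x$ imply $l\in I$. $\mathcal I_Q$ is the set of all ideals of $Q$. An ideal is proper if $I\neq Q$; $\mathrm{Max}_Q$ is the set of maximal ideals (proper ideals not properly contained in any other proper ideal). For a set $\Sigma_Q$ of proper ideals of $Q$ and $X\subseteq \mathcal I_Q$, put $X^{\uparrow}=\{J\in\Sigma_Q\mid \bigcap X\subseteq J\}$ if $X\neq\emptyset$ and $\emptyset^{\uparrow}=\emptyset$. The quantale topology on $\Sigma_Q$ is the topology having the sets $X^{\uparrow}$ ($X\subseteq \mathcal I_Q$) as a subbasis of closed sets; $\Sigma_Q$ with this topology is called a quantale space. A space is quasi-compact if every open cover has a finite subcover (no Hausdorff assumption). *)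

(* Defs.v *)
From HB Require Import structures.
From mathcomp Require Import all_boot all_order.
From mathcomp Require Import boolp classical_sets topology.

Set Implicit Arguments.
Unset Strict Implicit.
Unset Printing Implicit Defensive.

Import Order.TTheory.
Local Open Scope classical_set_scope.

(* Arbitrary joins are enough: the meet of a set is the join of its lower
   bounds. *)
HB.mixin Record isCompleteLattice d (Q : Type) & Order.TBLattice d Q := {
  bigsup : set Q -> Q;
  bigsupP : forall A : set Q, isLub A (bigsup A)
}.

#[short(type="completeLatticeType")]
HB.structure Definition CompleteLattice d :=
  { Q of Order.TBLattice d Q & isCompleteLattice d Q }.

HB.mixin Record isQuantale d (Q : Type) & CompleteLattice d Q := {
  qmul : Q -> Q -> Q;
  qmulA : associative qmul;
  qmulC : commutative qmul;
  qmul_bigsup : forall (x : Q) (A : set Q),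
    qmul x (bigsup A) = bigsup (qmul x @` A);
  qmulx1 : forall x : Q, qmul x (Order.top : Q) = x
}.

#[short(type="quantaleType")]
HB.structure Definition Quantale d :=
  { Q of CompleteLattice d Q & isQuantale d Q }.

Section Ideals.
Context {d : Order.disp_t} {Q : quantaleType d}.

Definition ideal (I : set Q) : Prop :=
  [/\ I !=set0,
      forall x y, I x -> I y -> I (Order.join x y)
    & forall x l, I x -> (l <= x)%O -> I l].

Definition proper_ideal (I : set Q) : Prop := ideal I /\ I <> setT.

Definition maximal_ideal (M : set Q) : Prop :=
  proper_ideal M /\ forall J, proper_ideal J -> ~ M `<` J.

(* A separate name for the carrier, so that it does not inherit a topology
   from the type [set Q]. *)
Definition quantale_space (S : set (set Q)) : Type := set_type S.

HB.instance Definition _ (S : set (set Q)) := gen_eqMixin (quantale_space S).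
HB.instance Definition _ (S : set (set Q)) :=
  gen_choiceMixin (quantale_space S).

Definition point_ideal (S : set (set Q)) (J : quantale_space S) : set Q :=
  val J.

(* The first conjunct makes [up set0] empty; the empty intersection alone
   would be [setT]. *)
Definition up (S : set (set Q)) (X : set (set Q)) : set (quantale_space S) :=
  [set J | X !=set0 /\ \bigcap_(I in X) I `<=` point_ideal J].

(* [isSubBaseTopological] takes a subbasis of open sets. *)
HB.instance Definition _ (S : set (set Q)) :=
  @isSubBaseTopological.Build (quantale_space S)
    (set (set Q)) [set X | X `<=` ideal] (fun X => ~` up X).

End Ideals.

(* Main.v *)
(* An ultrafilter [F] on the space converges: the elements [q] such that
   [F]-almost every point contains [q] form a proper ideal, and [F] converges to
   every maximal ideal [M] above it. Indeed, if [F] contained a subbasic closed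
   set [up X], then every element of the intersection of [X] would lie in
   [F]-almost every point, hence in [M], so that [M] would belong to [up X]. *)
Require Import Defs.
From mathcomp Require Import all_boot all_order.
From mathcomp Require Import finmap boolp classical_sets topology.

Import Order.TTheory.
Local Open Scope classical_set_scope.

(** If no finite subfamily covers [A], the sets [A] minus a finite union of the [f i] form a base of
    a proper filter. An ultrafilter above it converges to a point of some [f i], so it contains both
    [f i] and its complement. *)
Lemma compact_cover_compact (T : topologicalType) (A : set T) :
  compact A -> cover_compact A.
Proof.
rewrite compact_ultra => Aco I D f fop fcov.
apply: contrapT => nfin.
pose F := filter_from [set E : {fset I} | {subset E <= D}]
  (fun E => A `\` cover [set` E] f).
have FF : ProperFilter F.
  apply: filter_from_proper; last first.
    move=> E ED; apply/set0P/negP => /eqP; rewrite setD_eq0 => AE.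
    by apply: nfin; exists E.
  apply: filter_from_filter; first by exists fset0.
  move=> E1 E2 E1D E2D; exists (E1 `|` E2)%fset.
    by move=> i /fsetUP[/E1D|/E2D].
  move=> t [At nt]; split; split=> // -[i iE fit]; apply: nt; exists i => //=.
    by apply/fsetUP; left.
  by apply/fsetUP; right.
have [G [GU FG]] := ultraFilterLemma FF.
have [|p [Ap Gp]] := Aco G GU.
  by apply: FG; exists fset0 => // t [].
have [i Di fip] := fcov p Ap.
have Gi : G (f i) by apply: Gp; apply: open_nbhs_nbhs; split=> //; exact: fop.
have Gni : G (~` f i).
  apply: FG; exists [fset i]%fset.
    by move=> j /fset1P ->; exact/mem_set.
  by move=> t [_ nt] fit; apply: nt; exists i => //=; exact/fset1P.
by have [t []] := filter_ex (filterI Gi Gni).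
Qed.

Section Ideals.
Context {d : Order.disp_t} {Q : quantaleType d}.
Implicit Types (I K : set Q) (S : set (set Q)).

Lemma proper_idealP I : ideal I -> I <> setT <-> ~ I Order.top.
Proof.
move=> [_ _ Ile]; split=> [IT I1|nI1 IT]; last by apply: nI1; rewrite IT.
by apply: IT; apply/seteqP; split=> // x _; exact: (Ile _ _ I1 (lex1 x)).
Qed.

(** Zorn's lemma applies because properness of an ideal means omitting the top element, which unions
    of chains preserve. *)
Lemma maximal_ideal_above K :
  proper_ideal K -> exists2 M, maximal_ideal M & K `<=` M.
Proof.
move=> Kproper; have [K0 _ _] := Kproper.1.
(* [set0] is admitted because it is the union of the empty chain. *)
pose P A := A = set0 \/ proper_ideal A /\ K `<=` A.
have [C CP Ctot|M [[->|[Mproper KM]] Mmax]] := @Zorn_bigcup Q P.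
- have [->|/set0P[z [Z CZ Zz]]] := eqVneq (\bigcup_(X in C) X) set0.
    by left.
  have CI X x : C X -> X x -> proper_ideal X /\ K `<=` X.
    by move=> CX Xx; have [X0|//] := CP X CX; rewrite X0 in Xx.
  have Uideal : ideal (\bigcup_(X in C) X).
    split.
    + by exists z, Z.
    + move=> x y [X CX Xx] [Y CY Yy].
      have [XY|YX] := Ctot X Y CX CY.
        exists Y => //; have [[[_ + _] _] _] := CI Y y CY Yy.
        by apply=> //; exact: XY.
      exists X => //; have [[[_ + _] _] _] := CI X x CX Xx.
      by apply=> //; exact: YX.
    + move=> x l [X CX Xx] lx; exists X => //.
      by have [[[_ _ Xle] _] _] := CI X x CX Xx; exact: Xle lx.
  right; split; last first.
    by move=> x Kx; exists Z => //; apply: (CI Z z CZ Zz).2.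
  split=> //; apply/(proper_idealP _ Uideal) => -[X CX X1].
  have [[Xideal XT] _] := CI X _ CX X1.
  by move: X1; apply/proper_idealP.
(* The maximal element cannot be [set0]: the nonempty [K] lies strictly above it. *)
- case: (Mmax K); last by right; split.
  by split=> [//|K0']; have [x /K0'] := K0.
- exists M => //; split=> // J Jproper MJ; apply: (Mmax J MJ); right.
  by split=> //; apply: subset_trans KM MJ.1.
Qed.

(** The lower limit of the points along [F]: the union, over [E] in [F], of the intersection of the
    points in [E]. *)
Definition ideal_along S (F : set_system (quantale_space S)) : set Q :=
  [set q | F [set J | point_ideal J q]].

Lemma proper_ideal_along S (F : set_system (quantale_space S)) :
  S `<=` proper_ideal -> ProperFilter F -> proper_ideal (ideal_along S F).
Proof.
move=> Sproper FF.
have pointP (J : quantale_space S) : proper_ideal (point_ideal J).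
  by apply: Sproper; exact/set_mem/valP.
have Fideal : ideal (ideal_along S F).
  split.
  - exists Order.bottom; apply: filterE => J.
    have [[[x Jx] _ Jle] _] := pointP J.
    by apply: Jle Jx _; exact: le0x.
  - move=> x y; apply: filterS2 => J /=.
    by have [[_ JU _] _] := pointP J; exact: JU.
  - move=> x l Fx lx; apply: filterS Fx => J /= Jx.
    by have [[_ _ Jle] _] := pointP J; exact: Jle lx.
(* Members of [F] are inhabited, so top in the limit would put top in some point. *)
split=> //; apply/(proper_idealP _ Fideal) => /filter_ex[J].
by have [Jideal JT] := pointP J; exact/proper_idealP.
Qed.

(** Each neighbourhood of [p] contains a finite intersection of subbasic open sets around [p], and
    filters are closed under finite intersections. *)
Lemma cvg_up S (F : set_system (quantale_space S)) (p : quantale_space S) :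
  Filter F ->
  (forall X, X `<=` ideal -> ~ up X p -> F (~` up X)) -> F --> p.
Proof.
move=> FF Fup A; rewrite nbhsE => -[B [Bop Bp] BA]; apply: filterS BA _.
case: Bop Bp => C CD <- [U CU Up].
have [E ED EU] := CD U CU; rewrite -EU in CU Up.
apply: (@filterS _ F _ (\bigcap_(X in [set` E]) ~` up X)).
  by move=> J EJ; exists (\bigcap_(X in [set` E]) ~` up X).
apply: filter_bigI => X XE; apply: Fup; last exact: Up.
by have /set_mem := ED _ XE.
Qed.

End Ideals.

Theorem theorem4p1 (d : Order.disp_t) (Q : quantaleType d)
    (Sigma : set (set Q))
    (Sigma_proper : Sigma `<=` proper_ideal)
    (max_Sigma : maximal_ideal `<=` Sigma) :
  cover_compact [set: quantale_space Sigma].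
Proof.
apply: compact_cover_compact; rewrite compact_ultra => F FU _.
have [M Mmax FM] :=
  maximal_ideal_above _ (proper_ideal_along _ F Sigma_proper _).
pose p : quantale_space Sigma := SigSub (mem_set (max_Sigma _ Mmax)).
exists p; split=> //; apply: cvg_up => X _ nup.
have [FX|//] := in_ultra_setVsetC (up X) FU.
(* A point of [up X] witnesses that [X] is nonempty, the first condition for [p] to lie in
   [up X]. *)
have [J [X0 _]] := filter_ex FX.
case: nup; split=> // q Xq; apply: FM; apply: filterS FX => K [_]; exact.
Qed.
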